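(* Let $p$ be a prime number and $n$ a positive integer with $n\le p$. Every polynomial function $F$ on $\mathbb{Z}_{p^n}[\alpha]$ is uniquely represented by a polynomial $f\in\mathbb{Z}[\alpha][x]$ of the form \[ f(x)=\sum_{k=0}^{m}f_k(x)(x^p-x)^k+\sum_{i=0}^{np-1}b_ix^i\alpha\quad\text{with}\quad f_k(x)=\sum_{j=0}^{p-1}a_{jk}x^j, \] where $a_{jk},b_i\in\mathbb{Z}$ and (1) $m=\min(n,p-1)$; (2) $0\le a_{j0}<p^n$ and $0\le a_{jk}<p^{n-k+1}$ for $j=0,\ldots,p-1$ and $k=1,\ldots,m$; (3) $0\le b_i<\frac{p^n}{\gcd(p^n,i!)}$ for $i=0,\ldots,np-1$.
   Context: $\mathbb{Z}_m=\mathbb{Z}/m\mathbb{Z}$. For a commutative ring $R$ with $1$, the ring of dual numbers over $R$ is $R[\alpha]=R[x]/(x^2)$, where $\alpha=x+(x^2)$; so every element is uniquely $a+b\alpha$ with $a,b\in R$, and $\alpha^2=0$. A polynomial function on a finite commutative ring $A$ is a function $A\to A$ of the form $a\mapsto f(a)$ for some $f\in A[x]$. A polynomial $f\in\mathbb{Z}[\alpha][x]$ induces a function on $\mathbb{Z}_{p^n}[\alpha]$ by substitution (via reduction of its coefficients modulo $p^n$), and $f$ represents $F$ if the induced function is $F$. ''Uniquely represented'' means that there is exactly one polynomial of the given form (exactly one choice of the integers $a_{jk}$, $b_i$ in the given ranges) inducing $F$. *)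

(* Defs.v *)
From mathcomp Require Import all_boot all_order all_algebra.
From mathcomp Require Import qpoly.

Set Implicit Arguments.
Unset Strict Implicit.
Unset Printing Implicit Defensive.

Import GRing.Theory.
Local Open Scope ring_scope.

(* R[x]/(x^2) *)
Notation dual R := {poly %/ ('X^2 : {poly R})}.

Definition dual_alpha (R : comNzRingType) : dual R := in_qpoly 'X^2 'X.

(* The quotient map Z[alpha] -> Z_m[alpha]; the type 'Z_m is the ring of
   integers modulo m only for m > 1. *)
Definition dual_red (m : nat) (z : dual int) : dual 'Z_m :=
  in_qpoly 'X^2 (map_poly (intr : int -> 'Z_m) (val z)).

Definition polynomial_function (A : comNzRingType) (F : A -> A) : Prop :=
  exists f : {poly A}, forall x : A, F x = f.[x].

Definition represents (m : nat) (f : {poly dual int})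
    (F : dual 'Z_m -> dual 'Z_m) : Prop :=
  forall x : dual 'Z_m, F x = (map_poly (dual_red m) f).[x].

(* a j k is the coefficient of x^j in f_k. *)
Definition canonical_poly (p m N : nat)
    (a : 'M[int]_(p, m.+1)) (b : 'rV[int]_N) : {poly dual int} :=
  \sum_(k < m.+1)
     (\sum_(j < p) (a j k)%:~R *: 'X^j) * ('X^p - 'X) ^+ k
  + \sum_(i < N) ((b 0 i)%:~R * dual_alpha int) *: 'X^i.

Definition a_range (p n m : nat) (a : 'M[int]_(p, m.+1)) : Prop :=
  (forall j : 'I_p, 0 <= a j ord0 < (p ^ n)%N%:Z) /\
  (forall (j : 'I_p) (k : 'I_m.+1), (0 < k)%N ->
     0 <= a j k < (p ^ (n - k + 1))%N%:Z).

(* The division by the gcd is exact. *)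
Definition b_range (p n N : nat) (b : 'rV[int]_N) : Prop :=
  forall i : 'I_N,
    0 <= b 0 i < (p ^ n %/ gcdn (p ^ n) i`!)%N%:Z.

(* Main.v *)
Require Import Defs.
From HB Require Import structures.
From mathcomp Require Import all_boot all_order all_algebra.
From mathcomp Require Import finfield qpoly ring.

(* Write a polynomial over Z_M[alpha] as A + alpha B with A, B in Z[x]. Since
   alpha^2 = 0, its value at u + v alpha is A(u) + (v A'(u) + B(u)) alpha, so
   only the classes of A modulo { A : A and A' vanish mod M } and of B modulo
   { B : B vanishes mod M } matter.

   For A, put w = x^p - x and expand A = sum_k f_k w^k with deg f_k < p. On the
   residue class of r modulo p, f_k is constant modulo p while w / p runs through
   all residues; counting roots in F_p twice gives, by induction on n, that a sum
   with k < p vanishes mod p^n only if p^(n-k) divides f_k. Applying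
   this to A, and then to A', where w' is a unit at every integer, yields
   p^(n-k+1) | f_k for k > 0. Conversely p^(n-k+1) w^k and w^(m+1) vanish mod p^n
   together with their derivatives.

   For B, the leading coefficient of a polynomial of degree i vanishing mod M is
   divisible by M / gcd(M, i!), because its i-th finite difference is i! times
   that coefficient; the falling factorials show that this bound is attained. *)

Import Order.TTheory GRing.Theory Num.Theory.
Local Open Scope ring_scope.

(** * Dual numbers modulo M *)

Lemma polyC_intr (R : nzRingType) (z : int) : (z%:~R)%:P = z%:~R :> {poly R}.
Proof. exact: (rmorph_int (@polyC R)). Qed.

Lemma in_qpolyK {R : comNzRingType} (h : {poly R}) (z : {poly %/ h}) :
  in_qpoly h (val z) = z.
Proof. by apply: val_inj; apply: in_qpoly_small; rewrite size_mk_monic. Qed.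

Lemma in_qpoly_mk_monic {R : comNzRingType} (h : {poly R}) :
  in_qpoly h (mk_monic h) = 0.
Proof. by apply: val_inj => /=; rewrite Pdiv.RingMonic.rmodpp ?monic_mk_monic. Qed.

Lemma size_mk_monic_X2 (R : comNzRingType) : size (mk_monic ('X^2 : {poly R})) = 3%N.
Proof. by rewrite mk_monic_Xn size_polyXn. Qed.

Lemma dual_alpha_sqr (R : comNzRingType) : dual_alpha R * dual_alpha R = 0.
Proof.
rewrite /dual_alpha -in_qpolyM -expr2.
by rewrite -[X in in_qpoly _ X](mk_monic_Xn _ 2) in_qpoly_mk_monic.
Qed.

Lemma in_qpoly_intr {R : comNzRingType} (h : {poly R}) (z : int) :
  in_qpoly h z%:~R = z%:~R.
Proof. exact: (rmorph_int (in_qpoly h)). Qed.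

(** Reduction of coefficients sends multiples of X^2 to multiples of X^2, so [dual_red] may be
    computed on any representative; the morphism laws follow. *)
Lemma dual_red_in_qpoly (M : nat) (f : {poly int}) :
  dual_red M (in_qpoly 'X^2 f) = in_qpoly 'X^2 (map_poly (intr : int -> 'Z_M) f).
Proof.
rewrite [in RHS](Pdiv.RingMonic.rdivp_eq (monic_mk_monic ('X^2 : {poly int})) f).
rewrite rmorphD rmorphM /= in_qpolyD in_qpolyM.
suff -> : in_qpoly 'X^2 (map_poly (intr : int -> 'Z_M) (mk_monic 'X^2)) = 0.
  by rewrite mulr0 add0r.
by rewrite !mk_monic_Xn map_polyXn -[X in in_qpoly _ X](mk_monic_Xn _ 2) in_qpoly_mk_monic.
Qed.

Fact dual_red_zmod_morphism (M : nat) : zmod_morphism (dual_red M).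
Proof.
move=> x y; rewrite -(in_qpolyK _ x) -(in_qpolyK _ y).
by rewrite -(rmorphB (in_qpoly 'X^2)) !dual_red_in_qpoly !rmorphB.
Qed.

Fact dual_red_monoid_morphism (M : nat) : monoid_morphism (dual_red M).
Proof.
split=> [|x y]; first by rewrite -in_qpoly1 dual_red_in_qpoly rmorph1 in_qpoly1.
rewrite -(in_qpolyK _ x) -(in_qpolyK _ y).
by rewrite -in_qpolyM !dual_red_in_qpoly rmorphM in_qpolyM.
Qed.

HB.instance Definition _ (M : nat) :=
  GRing.isZmodMorphism.Build (dual int) (dual 'Z_M) (dual_red M)
    (dual_red_zmod_morphism M).
HB.instance Definition _ (M : nat) :=
  GRing.isMonoidMorphism.Build (dual int) (dual 'Z_M) (dual_red M)
    (dual_red_monoid_morphism M).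

Lemma dual_red_alpha (M : nat) : dual_red M (dual_alpha int) = dual_alpha 'Z_M.
Proof. by rewrite dual_red_in_qpoly map_polyX. Qed.

Lemma intr_Zp_eq0 (M : nat) (z : int) :
  (1 < M)%N -> ((z%:~R == 0 :> 'Z_M) = (M %| z)%Z).
Proof.
move=> M_gt1; rewrite dvdzE; case: z => n.
  by rewrite -val_eqE /= val_Zp_nat.
by rewrite NegzE mulrNz oppr_eq0 -val_eqE /= val_Zp_nat.
Qed.

Definition dual_int (M : nat) (u v : int) : dual 'Z_M :=
  u%:~R + v%:~R * dual_alpha 'Z_M.

Lemma dual_intE (M : nat) (u v : int) :
  dual_int M u v = in_qpoly 'X^2 (u%:~R + v%:~R * 'X).
Proof. by rewrite in_qpolyD in_qpolyM !in_qpoly_intr. Qed.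

Lemma dual_int_surj (M : nat) (x : dual 'Z_M) : exists u v, x = dual_int M u v.
Proof.
pose f : {poly 'Z_M} := val x.
have f_lt3 : (size f < 3)%N by rewrite -(size_mk_monic_X2 'Z_M) size_mk_monic.
(* Elements of ['Z_M] are ordinals; their values serve as integer lifts. *)
exists (f`_0)%R, (f`_1)%R; rewrite dual_intE -[LHS]in_qpolyK; congr in_qpoly.
rewrite -/f -[LHS]coefK; apply/polyP => i.
rewrite -!polyC_intr coef_poly coefD coefC mul_polyC coefZ coefX -!pmulrn !natr_Zp.
case: i => [|[|i]] /=.
- by rewrite mulr0 addr0; case: ltnP => // le0; rewrite nth_default.
- by rewrite mulr1 add0r; case: ltnP => // le1; rewrite nth_default.
- by rewrite mulr0 addr0; case: ltnP => // /leq_trans/(_ f_lt3).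
Qed.

Lemma dual_int_eq0 (M : nat) (u v : int) : (1 < M)%N ->
  dual_int M u v = 0 <-> (M %| u)%Z /\ (M %| v)%Z.
Proof.
move=> M_gt1; rewrite -!intr_Zp_eq0 //; split; last first.
  by case=> /eqP u0 /eqP v0; rewrite dual_intE -!polyC_intr u0 v0 mul0r addr0 in_qpoly0.
rewrite dual_intE => /(congr1 (@polyn _ _)).
rewrite in_qpoly_small; last first.
  rewrite size_mk_monic_X2 ltnS -!polyC_intr mul_polyC addrC.
  rewrite (leq_trans (size_polyD _ _)) // geq_max (leq_trans (size_polyC_leq1 _)) //.
  by rewrite andbT (leq_trans (size_scale_leq _ _)) // size_polyX.
rewrite -!polyC_intr mul_polyC => /polyP eq0.
have := eq0 0%N; have := eq0 1%N.
rewrite !coefD !coefC !coefZ !coefX /= mulr1 mulr0 addr0 add0r.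
by move=> -> ->.
Qed.

Definition dual_poly (M : nat) (A B : {poly int}) : {poly dual 'Z_M} :=
  map_poly intr A + (dual_alpha 'Z_M)%:P * map_poly intr B.

Lemma dual_poly_surj (M : nat) (f : {poly dual 'Z_M}) :
  exists A B, f = dual_poly M A B.
Proof.
elim/poly_ind: f => [|f c [A [B ->]]].
  by exists 0, 0; rewrite /dual_poly !rmorph0 mulr0 addr0.
have [u [v ->]] := dual_int_surj _ c.
exists (A * 'X + u%:P), (B * 'X + v%:P); rewrite /dual_poly /dual_int.
by rewrite !rmorphD !rmorphM /= !map_polyX !map_polyC /=; ring.
Qed.

Lemma horner_dual_poly (M : nat) (A B : {poly int}) (u v : int) :
  (dual_poly M A B).[dual_int M u v]
    = dual_int M A.[u] (v * (A^`()).[u] + B.[u]).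
Proof.
pose al := dual_alpha 'Z_M.
(* First-order Taylor expansion at u; the higher terms vanish as alpha^2 = 0. *)
have taylor (f : {poly int}) : (map_poly intr f).[dual_int M u v]
    = (f.[u])%:~R + (v * (f^`()).[u])%:~R * al.
  elim/poly_ind: f => [|f c IH].
    by rewrite rmorph0 deriv0 !horner0 mulr0 mul0r addr0.
  rewrite derivD derivM derivC derivX rmorphD rmorphM /= map_polyX map_polyC /=.
  rewrite !hornerE IH /dual_int -/al.
  have al2 : al * al = 0 by exact: dual_alpha_sqr.
  rewrite !(rmorphD, rmorphM) /=.
  set a := (f.[u])%:~R; set d := (f^`().[u])%:~R.
  have -> : (a + v%:~R * d * al) * (u%:~R + v%:~R * al) =
    a * u%:~R + v%:~R * (d * u%:~R + a) * al + v%:~R * v%:~R * d * (al * al) by ring.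
  by rewrite al2; ring.
rewrite /dual_poly hornerD hornerM hornerC !taylor /dual_int -/al.
rewrite mulrDr mulrCA dual_alpha_sqr mulr0 addr0 rmorphD /=; ring.
Qed.

(** * Integer polynomials vanishing modulo prime powers *)

Lemma Posz_exp (p n : nat) : (p ^ n)%N%:Z = p%:Z ^+ n.
Proof. by elim: n => // n IH; rewrite expnS exprS PoszM IH. Qed.

Definition vanishes_mod (M : nat) (f : {poly int}) :=
  forall x : int, (M %| f.[x])%Z.

Lemma vanishes_modD (M : nat) (f g : {poly int}) :
  vanishes_mod M f -> vanishes_mod M g -> vanishes_mod M (f + g).
Proof. by move=> f0 g0 x; rewrite hornerD rpredD. Qed.

Lemma vanishes_modMl (M : nat) (g f : {poly int}) :
  vanishes_mod M f -> vanishes_mod M (g * f).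
Proof. by move=> f0 x; rewrite hornerM dvdz_mull. Qed.

Definition dvanishes_mod (M : nat) (f : {poly int}) :=
  vanishes_mod M f /\ vanishes_mod M f^`().

Lemma dvanishes_modD (M : nat) (f g : {poly int}) :
  dvanishes_mod M f -> dvanishes_mod M g -> dvanishes_mod M (f + g).
Proof. by move=> [? ?] [? ?]; split; rewrite ?derivD; apply: vanishes_modD. Qed.

(** By the product rule, requiring the derivative to vanish as well still defines an ideal. *)
Lemma dvanishes_modMl (M : nat) (g f : {poly int}) :
  dvanishes_mod M f -> dvanishes_mod M (g * f).
Proof.
move=> [f0 df0]; split; first exact: vanishes_modMl.
by rewrite derivM; apply: vanishes_modD; apply: vanishes_modMl.
Qed.

Lemma dvanishes_mod_sum (M N : nat) (f : 'I_N -> {poly int}) :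
  (forall i, dvanishes_mod M (f i)) -> dvanishes_mod M (\sum_i f i).
Proof.
move=> f0; elim/big_ind: _ => // [|g h]; last exact: dvanishes_modD.
by split=> x; rewrite ?deriv0 horner0.
Qed.

Lemma dvdz_horner_sub (d : int) (f : {poly int}) (x y : int) :
  (d %| x - y)%Z -> (d %| f.[x] - f.[y])%Z.
Proof.
move=> dxy; have /factor_theorem[q fq] : root (f - f.[y]%:P) y.
  by rewrite /root !hornerE subrr.
have -> : f.[x] - f.[y] = (f - f.[y]%:P).[x] by rewrite !hornerE.
by rewrite fq !hornerE dvdz_mull.
Qed.

Section Prime.

Variables (p : nat) (p_prime : prime p).

Let dvdpE (z : int) : (p %| z)%Z = (z%:~R == 0 :> 'F_p).
Proof. exact/dvdz_pcharf/pchar_Fp. Qed.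

(** Modulo p, a nonzero polynomial of degree below p cannot have all p elements of F_p as roots. *)
Lemma dvdz_coef_of_vanishes (f : {poly int}) :
  (size f <= p)%N -> vanishes_mod p f -> forall i, (p %| f`_i)%Z.
Proof.
move=> f_size f0 i.
suff E : map_poly (intr : int -> 'F_p) f = 0.
  by rewrite dvdpE -(coef_map (intr : {rmorphism int -> 'F_p})) E coef0.
apply/eqP; apply: contraTT f_size => nz.
rewrite -ltnNge; apply: leq_trans (_ : (size (map_poly (intr : int -> 'F_p) f) <= _)%N).
  rewrite -[X in (X < _)%N](card_Fp p_prime) cardE; apply: max_poly_roots => //.
    apply/allP => x _; rewrite /root -[x]natr_Zp pmulrn horner_map -dvdpE; exact: f0.
  exact: enum_uniq.
exact: size_poly.
Qed.

Definition frob_poly : {poly int} := 'X^p - 'X.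

Lemma horner_frob (x : int) : frob_poly.[x] = x ^+ p - x.
Proof. by rewrite !hornerE. Qed.

(** Fermat's little theorem. *)
Lemma dvdz_horner_frob (x : int) : (p %| frob_poly.[x])%Z.
Proof.
rewrite horner_frob dvdpE rmorphB rmorphXn /=.
by rewrite -[X in _ - X]expf_card card_Fp ?subrr.
Qed.

Lemma vanishes_frob_exp (n : nat) : vanishes_mod (p ^ n) (frob_poly ^+ n).
Proof.
by move=> x; rewrite horner_exp Posz_exp dvdz_exp2r // dvdz_horner_frob.
Qed.

Let p_neq0 : p%:Z != 0.
Proof. by rewrite -lt0n prime_gt0. Qed.

(* On a residue class mod p, the quotient (x^p - x) / p runs through all
   residues mod p. *)
Lemma frob_quotient_shift (r t : int) :
  exists2 y : int, frob_poly.[r + p%:Z * t] = p%:Z * y &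
    y%:~R = (frob_poly.[r] %/ p)%Z%:~R - t%:~R :> 'F_p.
Proof.
(* [S] is the cofactor in (r + p t)^p - r^p = p t S. Modulo p its p terms all equal r^(p-1), so it
   vanishes and only -t remains. *)
set S := \sum_(i < p) (r + p%:Z * t) ^+ (p.-1 - i) * r ^+ i.
exists ((frob_poly.[r] %/ p)%Z + t * S - t).
  have E : (frob_poly.[r] %/ p)%Z * p%:Z = frob_poly.[r].
    by apply/eqP; rewrite -dvdz_eq dvdz_horner_frob.
  have ES := subrXX (r + p%:Z * t) r p; rewrite -/S in ES.
  rewrite mulrBr mulrDr [p%:Z * (_ %/ _)%Z]mulrC E !horner_frob.
  rewrite -[X in X - _ = _](subrK (r ^+ p)) ES; ring.
suff S0 : S%:~R = 0 :> 'F_p by rewrite !(rmorphB, rmorphD, rmorphM) /= S0 mulr0 addr0.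
have p0 : (p%:Z)%:~R = 0 :> 'F_p by apply/eqP; rewrite -dvdpE.
rewrite rmorph_sum /= (eq_bigr (fun=> (r ^+ p.-1)%:~R)) => [|i _].
  by rewrite sumr_const card_ord -mulr_natl pmulrn p0 mul0r.
rewrite rmorphM !rmorphXn rmorphD rmorphM /= p0 mul0r addr0 -exprD subnK //.
by rewrite -ltnS prednK ?prime_gt0.
Qed.

Lemma dvdz_coef_frob_expansion (n K : nat) (f : nat -> {poly int}) :
  (K <= p)%N -> (forall k, size (f k) <= p)%N ->
  vanishes_mod (p ^ n) (\sum_(k < K) f k * frob_poly ^+ k) ->
  forall k i, (k < K)%N -> ((p ^ (n - k))%N %| (f k)`_i)%Z.
Proof.
move=> K_le_p f_size; elim: n => [|n IH] f0 k i k_lt_K; first by rewrite dvd1z.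
have {}IH : forall k i, (k < K)%N -> ((p ^ (n - k))%N %| (f k)`_i)%Z.
  apply: IH => x; apply: dvdz_trans (f0 x).
  by rewrite !Posz_exp dvdz_exp2l.
(* The induction hypothesis makes [g j] the exact quotient of [f j] by p^(n-j). For j > n the term
   at w^j already vanishes modulo p^(n+1), hence the value 0. *)
pose g j : {poly int} := if (j <= n)%N
  then \poly_(i < p) ((f j)`_i %/ (p ^ (n - j))%N)%Z else 0.
have fg j : (j < K)%N -> (j <= n)%N -> f j = (p ^ (n - j))%N%:Z *: g j.
  move=> jK jn; rewrite /g jn; apply/polyP => l; rewrite coefZ coef_poly.
  case: ltnP => [_|lp]; last by rewrite mulr0 nth_default // (leq_trans (f_size j)).
  by rewrite mulrC; apply/esym/eqP; rewrite -dvdz_eq IH.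
have g_size j : (size (g j) <= p)%N.
  by rewrite /g; case: ifP; rewrite ?size_poly ?size_poly0.
(* Dividing the hypothesis by p^n leaves a congruence modulo p in y = w(x) / p. *)
have g_sum x y : frob_poly.[x] = p%:Z * y -> (p %| \sum_(j < K) (g j).[x] * y ^+ j)%Z.
  move=> xy; have := f0 x; rewrite horner_sum.
  rewrite -[X in _ -> is_true X](@dvdz_mul2l (p ^ n)%N%:Z); last by rewrite Posz_exp expf_neq0.
  rewrite -[(p ^ n)%N%:Z * p%:Z]PoszM -expnSr.
  set a := \sum_(_ < _) _; set b := _ * \sum_(_ < _) _ => a0.
  suff ab : ((p ^ n.+1)%N %| a - b)%Z by rewrite -(rpredBl _ a0) // opprK.
  rewrite /a /b mulr_sumr -sumrB; apply: rpred_sum => j _.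
  rewrite hornerM horner_exp xy exprMn.
  case: (leqP j n) => jn.
    rewrite fg // hornerZ !Posz_exp -{2}(subnK jn) exprD.
    suff -> : forall u v w z : int, u * v * (w * z) - u * w * (v * z) = 0 by rewrite rpred0.
    by move=> u v w z; ring.
  rewrite /g leqNgt jn /= horner0 mul0r mulr0 subr0 dvdz_mull // dvdz_mulr //.
  by rewrite Posz_exp dvdz_exp2l.
(* Moving x within the class of r modulo p fixes the values of each [g j] modulo p and lets y be
   arbitrary: r and y become independent. *)
have {}g_sum r y : (p %| \sum_(j < K) (g j).[r] * y ^+ j)%Z.
  have [z xz zE] := frob_quotient_shift r ((frob_poly.[r] %/ p)%Z - y).
  have := g_sum _ _ xz; rewrite !dvdpE !rmorph_sum /=.
  congr (_ == _); apply: eq_bigr => j _.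
  rewrite !rmorphM !rmorphXn /= zE rmorphB /= subKr.
  congr (_ * _); apply/eqP; rewrite -subr_eq0 -rmorphB -dvdpE.
  by apply: dvdz_horner_sub; rewrite addrC addKr dvdz_mulr.
(* First root count, in y: the polynomial with coefficients [(g j).[r]] has degree below K <= p. The
   second count, in r, ends the proof. *)
have g_coef j : (j < K)%N -> vanishes_mod p (g j).
  move=> jK r; pose G := \poly_(j < K) (g j).[r].
  have -> : (g j).[r] = G`_j by rewrite coef_poly jK.
  apply: dvdz_coef_of_vanishes; first exact: leq_trans (size_poly _ _) K_le_p.
  by move=> y; rewrite horner_poly.
case: (leqP k n) => kn; last first.
  by have /eqP -> : (n.+1 - k == 0)%N; rewrite ?dvd1z // subn_eq0.
rewrite fg // coefZ subSn // expnSr PoszM dvdz_mul //.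
by apply: dvdz_coef_of_vanishes => //; exact: g_coef.
Qed.

Lemma deriv_frob_exp (k : nat) :
  (frob_poly ^+ k)^`() = frob_poly^`() * frob_poly ^+ k.-1 *+ k.
Proof. by rewrite deriv_exp. Qed.

Lemma horner_deriv_frob (x : int) : frob_poly^`().[x] = p%:Z * x ^+ p.-1 - 1.
Proof.
by rewrite /frob_poly derivB derivXn derivX !hornerE hornerMn hornerXn -mulr_natl natz.
Qed.

(** The derivative is D + w' H with D = sum f_k' w^k and H = sum (k+1) f_(k+1) w^k. The bounds
    obtained from the values of the sum make D vanish, and w' is a unit modulo p, so H vanishes too.
    As f_(k+1) sits at w^k in H, its bound gains one power of p. *)
Lemma dvdz_coef_dfrob_expansion (n K : nat) (f : nat -> {poly int}) :
  (K <= p)%N -> (forall k, size (f k) <= p)%N ->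
  dvanishes_mod (p ^ n) (\sum_(k < K) f k * frob_poly ^+ k) ->
  forall k i, (k < K)%N ->
    ((p ^ (if k is k'.+1 then n - k' else n))%N %| (f k)`_i)%Z.
Proof.
move=> K_le_p f_size [f0 df0].
have f_dvd := dvdz_coef_frob_expansion n K f K_le_p f_size f0.
case=> [|k] i k_lt_K; first by rewrite -[in (p ^ n)%N](subn0 n); apply: f_dvd.
pose h j := f j.+1 *+ j.+1.
have h_size j : (size (h j) <= p)%N.
  by rewrite /h -scaler_nat (leq_trans (size_scale_leq _ _)).
have h0 : vanishes_mod (p ^ n) (\sum_(j < K.-1) h j * frob_poly ^+ j).
  move=> x; set H := \sum_(_ < _) _.
  have cop : coprimez (p ^ n)%N%:Z frob_poly^`().[x].
    rewrite Posz_exp horner_deriv_frob; case: (n) => [|n']; first by rewrite /coprimez gcd1z.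
    rewrite coprimez_pexpl //; apply/coprimezP.
    (* Bezout relation p x^(p-1) - w'(x) = 1. *)
    by exists (x ^+ p.-1, -1) => /=; ring.
  rewrite -(Gauss_dvdzr _ cop) -hornerM.
  set D := \sum_(k < K) (f k)^`() * frob_poly ^+ k.
  have E : (\sum_(k < K) f k * frob_poly ^+ k)^`() = D + frob_poly^`() * H.
    rewrite raddf_sum /= /D /H; case: (K) => [|K']; first by rewrite !big_ord0 mulr0 addr0.
    rewrite /= mulr_sumr (eq_bigr (fun k : 'I__ => (f k)^`() * frob_poly ^+ k
       + f k * (frob_poly ^+ k)^`())) => [|j _]; last by rewrite derivM.
    rewrite big_split /=; congr (_ + _).
    rewrite big_ord_recl /= expr0 derivC mulr0 add0r; apply: eq_bigr => j _.
    by rewrite deriv_frob_exp /h /bump /= add1n mulrnAr mulrnAl mulrnAr mulrCA.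
  have := df0 x; rewrite E hornerD rpredDl // /D horner_sum.
  apply: rpred_sum => j _; rewrite hornerM horner_exp.
  have d1 : ((p ^ (n - j))%N %| ((f j)^`()).[x])%Z.
    rewrite horner_coef; apply: rpred_sum => l _; rewrite dvdz_mulr //.
    by rewrite coef_deriv rpredMn // f_dvd.
  have d2 : ((p ^ j)%N %| frob_poly.[x] ^+ j)%Z.
    by rewrite -horner_exp vanishes_frob_exp.
  apply: dvdz_trans (dvdz_mul d1 d2); rewrite -PoszM -expnD Posz_exp Posz_exp.
  by apply: dvdz_exp2l; rewrite addnC -leq_subLR.
have := dvdz_coef_frob_expansion _ _ _ (leq_trans (leq_pred K) K_le_p) h_size h0.
move/(_ k i); rewrite -ltnS prednK; last exact: leq_trans k_lt_K.
(* The factor k+1 < p is prime to p and cancels. *)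
move/(_ k_lt_K); rewrite /h coefMn -mulr_natl natz Gauss_dvdzr //.
rewrite Posz_exp; case: (n - k)%N => [|l]; first by rewrite /coprimez gcd1z.
rewrite coprimez_pexpl // /coprimez -[gcdz _ _]/(gcdn p k.+1)%:Z.
have : coprime p k.+1 by rewrite prime_coprime // gtnNdvd // (leq_trans k_lt_K).
by rewrite /coprime => /eqP ->.
Qed.

End Prime.

(** * Equality of polynomial functions on the dual numbers *)

Lemma dual_poly_eq (M : nat) (A B A' B' : {poly int}) : (1 < M)%N ->
  (forall x, (dual_poly M A B).[x] = (dual_poly M A' B').[x]) <->
  dvanishes_mod M (A - A') /\ vanishes_mod M (B - B').
Proof.
move=> M_gt1.
have sub u v : (dual_poly M A B).[dual_int M u v] - (dual_poly M A' B').[dual_int M u v]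
    = dual_int M (A - A').[u] (v * (A - A')^`().[u] + (B - B').[u]).
  rewrite !horner_dual_poly /dual_int derivB !hornerE /=.
  by rewrite !(rmorphB, rmorphD, rmorphM) /=; ring.
split=> [E|[[A0 dA0] B0] x].
  have E0 u v : (M %| (A - A').[u])%Z /\ (M %| v * (A - A')^`().[u] + (B - B').[u])%Z.
    by apply/(dual_int_eq0 _ _ _ M_gt1); rewrite -sub E subrr.
  (* The alpha part is affine in v: v = 0 isolates B - B', and v = 1 then isolates the derivative of
     A - A'. *)
  have B0 u : (M %| (B - B').[u])%Z by have [_] := E0 u 0; rewrite mul0r add0r.
  split=> //; split=> u; first by have [] := E0 u 0.
  by have [_] := E0 u 1; rewrite mul1r rpredDr.
have [u [v ->]] := dual_int_surj _ x.
apply/eqP; rewrite -subr_eq0 sub; apply/eqP/dual_int_eq0 => //.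
by split; [exact: A0 | rewrite rpredD // dvdz_mull].
Qed.

Lemma eq_of_dvdz_sub (d x y : int) :
  0 <= x < d -> 0 <= y < d -> (d %| x - y)%Z -> x = y.
Proof.
move=> xd yd; rewrite -eqz_mod_dvd => /eqP.
have d_ge0 : 0 <= d by case/andP: xd => x0 /ltW; exact: le_trans.
by rewrite !modz_small ?(ger0_norm d_ge0).
Qed.

(** The lemmas on expansions index families by [nat]; a finite family is extended by a default value
    to fit them. *)
Definition ord_ext {T : Type} (x0 : T) {N : nat} (f : 'I_N -> T) (i : nat) : T :=
  oapp f x0 (insub i).

Lemma ord_extE {T : Type} (x0 : T) {N : nat} (f : 'I_N -> T) (i : 'I_N) :
  ord_ext x0 f i = f i.
Proof. by rewrite /ord_ext valK. Qed.

Lemma coef_sum_ord {R : nzRingType} (N : nat) (c : 'I_N -> R) (i : 'I_N) :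
  (\sum_(j < N) c j *: 'X^j)`_i = c i.
Proof.
rewrite coef_sum (bigD1 i) //= coefZ coefXn eqxx mulr1 big1 ?addr0 // => j ji.
by rewrite coefZ coefXn (inj_eq val_inj) eq_sym (negbTE ji) mulr0.
Qed.

Lemma size_sum_ord {R : nzRingType} (N : nat) (c : 'I_N -> R) :
  (size (\sum_(j < N) c j *: 'X^j : {poly R})%R <= N)%N.
Proof.
apply: (leq_trans (size_sum _ _ _)); apply/bigmax_leqP => j _.
by rewrite (leq_trans (size_scale_leq _ _)) // size_polyXn.
Qed.

(** * Canonical digits in powers of x^p - x *)

Section FrobExpansion.

Variables (p : nat) (p_prime : prime p).

Let w := frob_poly p.

Lemma size_frob : size w = p.+1.
Proof.
rewrite /w /frob_poly size_polyDl ?size_polyXn // size_polyN size_polyX.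
exact: prime_gt1.
Qed.

Lemma monic_frob : w \is monic.
Proof.
rewrite monicE /w /frob_poly lead_coefDl ?lead_coefXn //.
by rewrite size_polyN size_polyX size_polyXn ltnS prime_gt1.
Qed.

Lemma size_exp_frob (k : nat) : size (w ^+ k) = (k * p).+1.
Proof.
elim: k => [|k IH]; first by rewrite expr0 size_poly1.
by rewrite exprS size_monicM ?monic_neq0 ?monic_exp ?monic_frob // IH size_frob mulSn addnS.
Qed.

(** Repeated division by the monic w: the last quotient is divided once more, and its remainder is
    the next digit. *)
Lemma frob_expansion (K : nat) (A : {poly int}) :
  exists Q (f : nat -> {poly int}),
    (forall k, size (f k) <= p)%N /\ A = Q * w ^+ K + \sum_(k < K) f k * w ^+ k.
Proof.
elim: K => [|K [Q [f [f_size ->]]]].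
  exists A, (fun=> 0); split=> [k|]; first by rewrite size_poly0.
  by rewrite big_ord0 expr0 mulr1 addr0.
exists (Pdiv.CommonRing.rdivp Q w).
exists (fun k => if k == K then Pdiv.CommonRing.rmodp Q w else f k); split=> [k|].
  case: eqP => // _; rewrite -ltnS -size_frob; apply: Pdiv.CommonRing.ltn_rmodpN0.
  by rewrite monic_neq0 ?monic_frob.
rewrite big_ord_recr /= eqxx {1}(Pdiv.RingMonic.rdivp_eq monic_frob Q).
rewrite [in RHS](eq_bigr (fun k : 'I_K => f k * w ^+ k)) => [|k _]; last first.
  by rewrite /= ltn_eqF.
by rewrite exprS; ring.
Qed.

(* The values of A determine its digit at w^k modulo p^(n-k); differentiating
   w^k costs one factor w, so A' determines it modulo p^(n-(k-1)) when k > 0. *)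
Definition frob_digit_exp (n k : nat) : nat := if k is k'.+1 then n - k' else n.

(** For k > 0, p^k divides the values of w^k and p^(k-1) those of its derivative k w' w^(k-1); the
    scalar supplies the missing powers. *)
Lemma dvanishes_frob_digit (n k : nat) :
  dvanishes_mod (p ^ n) ((p ^ frob_digit_exp n k)%N%:Z *: w ^+ k).
Proof.
have dvd_wX l x : ((p ^ l)%N %| w.[x] ^+ l)%Z.
  by rewrite -horner_exp; apply: vanishes_frob_exp.
have dvd_le l y : (n <= frob_digit_exp n k + l)%N -> ((p ^ l)%N %| y)%Z ->
    ((p ^ n)%N %| (p ^ frob_digit_exp n k)%N%:Z * y)%Z.
  move=> le_n /(dvdz_mul (dvdzz (p ^ frob_digit_exp n k)%N)).
  by apply: dvdz_trans; rewrite -PoszM -expnD !Posz_exp dvdz_exp2l.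
split=> x.
  rewrite hornerZ horner_exp; apply: (dvd_le k); last exact: dvd_wX.
  case: k {dvd_le} => [|k] /=; first by rewrite addn0.
  by rewrite addnS ltnW // ltnS addnC -leq_subLR.
case: k dvd_le => [|k] dvd_le; first by rewrite expr0 alg_polyC derivC horner0.
rewrite derivZ hornerZ deriv_frob_exp hornerMn hornerM horner_exp.
apply: (dvd_le k); first by rewrite /= addnC -leq_subLR.
by rewrite rpredMn // dvdz_mull //; apply: dvd_wX.
Qed.

(** For n < p the derivative of w^(n+1) still contains w^n. For n = p the exponent is only p, and
    the missing factor p comes from differentiating: (w^p)' = p w' w^(p-1). *)
Lemma dvanishes_frob_top (n : nat) : (n <= p)%N ->
  dvanishes_mod (p ^ n) (w ^+ (minn n p.-1).+1).
Proof.
move=> n_le_p; have p_gt0 := prime_gt0 p_prime.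
have dvd_wX l x : ((p ^ l)%N %| w.[x] ^+ l)%Z.
  by rewrite -horner_exp; apply: vanishes_frob_exp.
have dvd_w k y x : (n <= k)%N -> ((p ^ k)%N %| y * w.[x] ^+ k)%Z -> ((p ^ n)%N %| y * w.[x] ^+ k)%Z.
  by move=> nk; apply: dvdz_trans; rewrite !Posz_exp dvdz_exp2l.
have n_le : (n <= (minn n p.-1).+1)%N.
  by rewrite -minnSS leq_min leqnSn prednK.
split=> x.
  by rewrite horner_exp -[_ ^+ _]mul1r dvd_w // dvdz_mull.
rewrite deriv_frob_exp hornerMn hornerM horner_exp /=.
case: (leqP n p.-1) => [n_le' | lt_n].
  by rewrite rpredMn // dvdz_mull.
have -> : n = p by apply/eqP; rewrite eqn_leq n_le_p -(prednK p_gt0).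
rewrite prednK // -mulrnAr dvdz_mull // -mulr_natl natz.
by rewrite -[X in (p ^ X)%N](prednK p_gt0) expnS PoszM dvdz_mul.
Qed.

Section Digits.

Variables (n m : nat).

Definition frob_digits (a : 'M[int]_(p, m.+1)) : {poly int} :=
  \sum_(k < m.+1) (\sum_(j < p) a j k *: 'X^j) * w ^+ k.

Definition digit_range (a : 'M[int]_(p, m.+1)) : Prop :=
  forall j k, 0 <= a j k < (p ^ frob_digit_exp n k)%N%:Z.

(** Each entry of the difference is divisible by the bound of its own range. *)
Lemma frob_digits_inj (a a' : 'M[int]_(p, m.+1)) : (m < p)%N ->
  digit_range a -> digit_range a' ->
  dvanishes_mod (p ^ n) (frob_digits a - frob_digits a') -> a = a'.
Proof.
move=> m_lt_p a_r a'_r d0; apply/matrixP => j k.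
pose f := ord_ext 0 (fun k : 'I_m.+1 => \sum_(j < p) (a j k - a' j k) *: 'X^j : {poly int}).
have fE : \sum_(k < m.+1) f k * w ^+ k = frob_digits a - frob_digits a'.
  rewrite /frob_digits -sumrB; apply: eq_bigr => l _; rewrite /f ord_extE -mulrBl -sumrB.
  by congr (_ * _); apply: eq_bigr => i _; rewrite scalerBl.
apply: eq_of_dvdz_sub (a_r j k) (a'_r j k) _.
have <- : (f k)`_j = a j k - a' j k.
  by rewrite /f ord_extE (coef_sum_ord _ (fun j => a j k - a' j k)).
apply: (dvdz_coef_dfrob_expansion _ p_prime n m.+1 f) => //; last by rewrite fE.
move=> i; rewrite /f /ord_ext; case: insub => [l|] /=; rewrite ?size_poly0 //.
exact: size_sum_ord.
Qed.

(** Reducing each coefficient of the expansion modulo its bound discards only multiples of the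
    polynomials in [dvanishes_frob_digit]; the hypothesis on w^(m+1) disposes of the quotient. *)
Lemma frob_digits_surj (A : {poly int}) :
  dvanishes_mod (p ^ n) (w ^+ m.+1) ->
  exists2 a, digit_range a & dvanishes_mod (p ^ n) (A - frob_digits a).
Proof.
move=> top; have [Q [f [f_size ->]]] := frob_expansion m.+1 A.
pose d k := (p ^ frob_digit_exp n k)%N%:Z.
have d_gt0 k : 0 < d k by rewrite /d ltz_nat expn_gt0 prime_gt0.
exists (\matrix_(j, k) ((f k)`_j %% d k)%Z).
  move=> j k; rewrite mxE modz_ge0 ?lt0r_neq0 //=.
  exact: ltz_pmod.
rewrite -addrA; apply: dvanishes_modD; first exact: dvanishes_modMl.
rewrite /frob_digits -sumrB; apply: dvanishes_mod_sum => k.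
rewrite -mulrBl.
suff -> : f k - \sum_(j < p) (\matrix_(j, k) ((f k)`_j %% d k)%Z) j k *: 'X^j
    = (\sum_(j < p) ((f k)`_j %/ d k)%Z *: 'X^j) * (d k)%:P.
  rewrite -mulrA mul_polyC; apply: dvanishes_modMl; exact: dvanishes_frob_digit.
have {1}-> : f k = \sum_(j < p) (f k)`_j *: 'X^j.
  by rewrite -poly_def; apply/polyP => i; rewrite coef_poly; case: ltnP => // pi;
     rewrite nth_default // (leq_trans (f_size k)).
rewrite mulrC mul_polyC scaler_sumr -sumrB; apply: eq_bigr => j _.
by rewrite mxE scalerA -scalerBl {1}(divz_eq (f k)`_j (d k)) addrK mulrC.
Qed.

End Digits.

End FrobExpansion.

(** * Falling factorials and normal forms modulo M *)

Definition ff_poly (i : nat) : {poly int} := \prod_(0 <= j < i) ('X - (j%:Z)%:P).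

Lemma monic_ff_poly (i : nat) : ff_poly i \is monic.
Proof. by apply: monic_prod => j _; apply: monicXsubC. Qed.

Lemma size_ff_poly (i : nat) : size (ff_poly i) = i.+1.
Proof. by rewrite size_prod_XsubC size_iota subn0. Qed.

Lemma horner_ff_poly (i x : nat) : (ff_poly i).[x%:Z] = (x ^_ i)%N%:Z.
Proof.
elim: i => [|i IH]; first by rewrite /ff_poly big_geq // hornerE.
rewrite /ff_poly big_nat_recr //= hornerM IH hornerXsubC ffactnSr PoszM.
case: (leqP i x) => ix; first by rewrite subzn.
by rewrite ffact_small // !mul0r.
Qed.

(** At a natural number the value is i! times a binomial coefficient; periodicity modulo i! reaches
    every integer. *)
Lemma vanishes_ff_poly (i : nat) : vanishes_mod i`! (ff_poly i).
Proof.
move=> x.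
have nz : (i`!%:Z != 0) by rewrite -lt0n fact_gt0.
pose y := `|(x %% i`!%:Z)%Z|%N.
have yE : y%:Z = (x %% i`!%:Z)%Z by rewrite /y gez0_abs // modz_ge0.
have xy : (i`! %| x - y%:Z)%Z by rewrite -eqz_mod_dvd yE modz_mod.
rewrite -(rpredBr _ (_ : (ff_poly i).[y] \in dvdz i`!)); last first.
  by rewrite horner_ff_poly -bin_ffact PoszM; apply: dvdz_mull.
exact: dvdz_horner_sub.
Qed.

(** Binomial theorem; [N] is any bound on the size, so that the top terms can be split off at fixed
    indices. *)
Lemma coef_comp_XD1 (f : {poly int}) (N n : nat) : (size f <= N)%N ->
  (f \Po ('X + 1))`_n = \sum_(i < N) f`_i *+ 'C(i, n).
Proof.
move=> fN; rewrite coef_comp_poly.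
rewrite [RHS](bigID (fun i : 'I_N => (i < size f)%N)) /=.
rewrite [X in _ = _ + X]big1 ?addr0; last first.
  by move=> i; rewrite -leqNgt => ?; rewrite nth_default // mul0rn.
rewrite (big_ord_widen _ (fun i => f`_i * (('X + 1) ^+ i)`_n) fN).
apply: eq_bigr => i _; rewrite -mulr_natr; congr (_ * _).
rewrite exprD1n coef_sum.
under eq_bigr => j _ do rewrite coefMn coefXn.
case: (ltnP n i.+1) => ni.
  rewrite (bigD1 (Ordinal ni)) //= eqxx big1 ?addr0 ?natz // => j.
  by rewrite -val_eqE eq_sym /= => /negbTE ->; rewrite mul0rn.
rewrite bin_small // big1 // => j _.
by rewrite eq_sym ltn_eqF ?mul0rn // (leq_trans (ltn_ord j)).
Qed.

(* The N-th finite difference of f is the constant N! f_N. *)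
Lemma dvdz_fact_lead (M N : nat) (f : {poly int}) : (size f <= N.+1)%N ->
  vanishes_mod M f -> (M %| N`!%:Z * f`_N)%Z.
Proof.
elim: N f => [|N IH] f f_size f0.
  have := f0 0; rewrite horner_coef0 fact0 mul1r //.
(* Forward difference: the coefficient in degree N+1 cancels, and (N+1) f_(N+1) remains in degree N,
   so the factorial builds up. *)
pose g := f \Po ('X + 1) - f.
have small n (i : 'I_N) : (N <= n)%N -> f`_i *+ 'C(i, n) = 0.
  by move=> Nn; rewrite bin_small ?mulr0n // (leq_trans (ltn_ord i)).
have gE n : (N <= n)%N -> g`_n = f`_N *+ 'C(N, n) + f`_N.+1 *+ 'C(N.+1, n) - f`_n.
  move=> Nn; rewrite coefB (coef_comp_XD1 _ _ _ f_size) !big_ord_recr /=.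
  by rewrite big1 ?add0r // => i _; exact: small.
have g_size : (size g <= N.+1)%N.
  apply/leq_sizeP => n; rewrite leq_eqVlt => /predU1P[<-|Nn].
    by rewrite gE // binn bin_small // mulr0n add0r subrr.
  rewrite gE ?(ltnW (ltnW Nn)) // !bin_small ?(ltnW Nn) //.
  by rewrite !mulr0n add0r nth_default ?subr0 // (leq_trans f_size).
have g0 : vanishes_mod M g.
  by move=> x; rewrite /g hornerD hornerN horner_comp rpredB.
have := IH g g_size g0.
rewrite gE // binn binSn mulr1n addrC addKr factS PoszM -mulr_natl natz.
by rewrite mulrCA mulrA.
Qed.

Section Monomials.

Variable (M : nat).
Hypothesis M_gt0 : (0 < M)%N.

(** [d i] is the least positive integer c such that M divides c i!. *)
Let d i := (M %/ gcdn M i`!)%N.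

Let dE i : (d i * gcdn M i`!)%N = M.
Proof. by rewrite divnK // dvdn_gcdl. Qed.

Let d_gt0 i : (0 < d i)%N.
Proof. by rewrite divn_gt0 ?gcdn_gt0 ?M_gt0 // dvdn_leq ?dvdn_gcdl. Qed.

Lemma vanishes_scale_ff_poly (i : nat) : vanishes_mod M ((d i)%:Z *: ff_poly i).
Proof.
move=> x; rewrite hornerZ -[in (M %| _)%Z](dE i) PoszM dvdz_mul //.
by apply: dvdz_trans (vanishes_ff_poly i x); rewrite dvdzE dvdn_gcdr.
Qed.

(** M divides both M c and i! c, hence gcd(M, i!) c; then the gcd cancels. *)
Lemma dvdz_quot_gcd_fact (i : nat) (c : int) :
  (M %| i`!%:Z * c)%Z -> (d i %| c)%Z.
Proof.
rewrite !dvdzE abszM /= => Mc.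
have : (M %| gcdn M i`! * `|c|)%N by rewrite muln_gcdl dvdn_gcd Mc dvdn_mulr.
by rewrite -{1}(dE i) mulnC dvdn_pmul2l // gcdn_gt0 M_gt0.
Qed.

(** Leading coefficients come first: they agree by [dvdz_fact_lead], after which the top terms
    cancel and the degree drops. *)
Lemma monomials_inj (N : nat) (b b' : nat -> int) :
  (forall i, 0 <= b i < d i) -> (forall i, 0 <= b' i < d i) ->
  vanishes_mod M (\sum_(i < N) b i *: 'X^i - \sum_(i < N) b' i *: 'X^i) ->
  forall i, (i < N)%N -> b i = b' i.
Proof.
move=> b_r b'_r; elim: N => [|N IH] // v0.
have E : \sum_(i < N.+1) b i *: 'X^i - \sum_(i < N.+1) b' i *: 'X^i
    = \sum_(i < N.+1) (b i - b' i) *: 'X^i :> {poly int}.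
  by rewrite -sumrB; apply: eq_bigr => i _; rewrite scalerBl.
have bN : b N = b' N.
  apply: eq_of_dvdz_sub (b_r N) (b'_r N) _; apply: dvdz_quot_gcd_fact.
  rewrite -(coef_sum_ord _ (fun i => b i - b' i) ord_max) -E.
  by apply: dvdz_fact_lead; rewrite // E size_sum_ord.
move=> i; rewrite ltnS leq_eqVlt => /predU1P[-> //|]; apply: IH.
by move: v0; rewrite !big_ord_recr /= bN opprD addrACA subrr addr0.
Qed.

Lemma monomials_surj (N : nat) (B : {poly int}) : (size B <= N)%N ->
  exists2 b : nat -> int, (forall i, 0 <= b i < d i) &
    vanishes_mod M (B - \sum_(i < N) b i *: 'X^i).
Proof.
elim: N B => [|N IH] B B_size.
  exists (fun=> 0) => [i|x]; first by rewrite lexx ltz_nat d_gt0.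
  by move: B_size; rewrite leqn0 size_poly_eq0 => /eqP ->; rewrite big_ord0 subr0 horner0.
pose r := (B`_N %% d N)%Z; pose q := (B`_N %/ d N)%Z.
(* The remainder of the leading coefficient stays as a digit, and the quotient multiplies a null
   polynomial with leading coefficient [d N]; the degree drops. *)
pose C := B - r *: 'X^N - q *: ((d N)%:Z *: ff_poly N).
have [|b b_r b0] := IH C.
  apply/leq_sizeP => j; rewrite !coefB !coefZ coefXn leq_eqVlt => /predU1P[<-|Nj].
    have -> : (ff_poly N)`_N = 1.
      by have /monicP := monic_ff_poly N; rewrite lead_coefE size_ff_poly.
    by rewrite eqxx !mulr1 {1}(divz_eq B`_N (d N)) -/q -/r addrK subrr.
  rewrite gtn_eqF // !nth_default ?size_ff_poly ?mulr0 ?subrr //.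
  exact: leq_trans Nj.
exists (fun i => if i == N then r else b i) => [i|].
  case: eqP => // ->; have dN : 0 < (d N)%:Z by rewrite ltz_nat d_gt0.
  by rewrite modz_ge0 ?ltz_pmod ?lt0r_neq0.
rewrite big_ord_recr /= eqxx (eq_bigr (fun i : 'I_N => b i *: 'X^i)) => [|i _]; last first.
  by rewrite /= ltn_eqF.
have -> : B - (\sum_(i < N) b i *: 'X^i + r *: 'X^N) =
    (C - \sum_(i < N) b i *: 'X^i) + q%:P * ((d N)%:Z *: ff_poly N).
  by rewrite /C mul_polyC; ring.
apply: vanishes_modD => //; apply: vanishes_modMl; exact: vanishes_scale_ff_poly.
Qed.

End Monomials.

(** Since w^n vanishes modulo p^n, only a remainder of degree below n p is left to reduce; hence the
    n p monomials. *)
Lemma monomials_surj_frob (p n : nat) (B : {poly int}) : prime p ->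
  exists2 b : nat -> int, (forall i, 0 <= b i < (p ^ n %/ gcdn (p ^ n) i`!)%N%:Z) &
    vanishes_mod (p ^ n) (B - \sum_(i < n * p) b i *: 'X^i).
Proof.
move=> p_prime.
have [Q [f [f_size ->]]] := frob_expansion p p_prime n B.
set C := \sum_(k < n) _.
have C_size : (size C <= n * p)%N.
  apply: (leq_trans (size_sum _ _ _)); apply/bigmax_leqP => k _.
  have [->|fk] := eqVneq (f k) 0; first by rewrite mul0r size_poly0.
  have w_monic : frob_poly p ^+ k \is monic by rewrite monic_exp // monic_frob.
  rewrite size_Mmonic // size_exp_frob //.
  rewrite addnS /= (leq_trans (leq_add (f_size k) (leqnn _))) //.
  by rewrite -mulSn leq_mul2r ltn_ord orbT.
have M_gt0 : (0 < p ^ n)%N by rewrite expn_gt0 prime_gt0.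
have [b b_r b0] := monomials_surj _ M_gt0 _ C C_size.
exists b => //; rewrite -addrA; apply: vanishes_modD => //.
by apply: vanishes_modMl; apply: vanishes_frob_exp.
Qed.

(** * Assembly of the canonical form *)

Lemma dual_red_canonical_poly (M p m N : nat) (a : 'M[int]_(p, m.+1)) (b : 'rV[int]_N) :
  map_poly (dual_red M) (canonical_poly a b)
    = dual_poly M (frob_digits p m a) (\sum_(i < N) b 0 i *: 'X^i).
Proof.
rewrite /canonical_poly /dual_poly /frob_digits /frob_poly rmorphD !rmorph_sum /=.
congr (_ + _).
  apply: eq_bigr => k _; rewrite !rmorphM !rmorphXn !rmorphB /= !map_polyXn !map_polyX.
  congr (_ * _); rewrite !rmorph_sum /=; apply: eq_bigr => j _.
  by rewrite !map_polyZ !map_polyXn rmorph_int.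
rewrite mulr_sumr; apply: eq_bigr => i _.
rewrite !map_polyZ !map_polyXn rmorphM rmorph_int /= dual_red_alpha.
by rewrite mul_polyC scalerA mulrC.
Qed.

(** Subtraction is truncated: n - k + 1 = n - (k - 1) for k > 0 requires k <= n, which the minimum
    ensures. *)
Lemma a_range_digit (p n : nat) (a : 'M[int]_(p, (minn n p.-1).+1)) :
  a_range n a <-> digit_range p n (minn n p.-1) a.
Proof.
have eqe (k : 'I_(minn n p.-1).+1) : (0 < k)%N -> (n - k + 1 = frob_digit_exp n k)%N.
  case: k => [[|k]] //= kn _; rewrite addn1 subnSK //.
  by move: kn; rewrite ltnS leq_min => /andP[].
split=> [[a0 ak] j k|a_r].
  have [k0|k_gt0] := posnP k; last by rewrite -eqe //; exact: ak.
  by have -> : k = ord0; [exact: val_inj | exact: a0].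
split=> [j|j k k_gt0]; first exact: (a_r j ord0).
by rewrite eqe.
Qed.

Theorem theorem9p4 (p n : nat) (p_prime : prime p) (n_gt0 : (0 < n)%N)
    (n_le_p : (n <= p)%N)
    (F : dual 'Z_(p ^ n) -> dual 'Z_(p ^ n)) (F_poly : polynomial_function F) :
  exists! ab : 'M[int]_(p, (minn n p.-1).+1) * 'rV[int]_(n * p),
    [/\ a_range n ab.1, b_range p n ab.2
      & represents (canonical_poly ab.1 ab.2) F].
Proof.
have M_gt1 : (1 < p ^ n)%N by rewrite -(exp1n n) ltn_exp2r // prime_gt1.
have [f Ff] := F_poly; have [A [B fAB]] := dual_poly_surj _ f.
have [a a_r aA] := frob_digits_surj p p_prime n _ A (dvanishes_frob_top p p_prime n n_le_p).
have [b b_r bB] := monomials_surj_frob p n B p_prime.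
have bE : \sum_(i < n * p) (\row_(i < n * p) b i) 0 i *: 'X^i
    = \sum_(i < n * p) b i *: 'X^i :> {poly int}.
  by apply: eq_bigr => i _; rewrite mxE.
have repr : represents (canonical_poly a (\row_(i < n * p) b i)) F.
  move=> x; rewrite dual_red_canonical_poly bE Ff fAB.
  by move: x; apply/(dual_poly_eq _ _ _ _ _ M_gt1).
exists (a, \row_i b i); split=> /= [|[a' b'] /= [/a_range_digit a'_r b'_r repr']].
  by split=> //; [exact/a_range_digit | move=> i; rewrite mxE].
(* Two representations of F induce the same function, so the parts without and with alpha compare
   separately. *)
have [|a_eq b_eq] := (dual_poly_eq _ (frob_digits p _ a) (\sum_(i < n * p) b i *: 'X^i)
    (frob_digits p _ a') (\sum_(i < n * p) b' 0 i *: 'X^i) M_gt1).1.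
  by move=> x; rewrite -bE -!dual_red_canonical_poly -repr -repr'.
congr (_, _).
  apply: (frob_digits_inj p p_prime n _ a a') => //.
  by rewrite -(prednK (prime_gt0 p_prime)) ltnS geq_minr.
apply/rowP => i; rewrite mxE.
(* Outside the row the default 0 is in range, as the bound exceeds [b j] >= 0. *)
pose b'' := ord_ext 0 (b' 0).
have b''E (j : 'I_(n * p)) : b'' j = b' 0 j by exact: ord_extE.
rewrite -b''E; apply: (monomials_inj (p ^ n) (ltnW M_gt1) (n * p)) => //.
- move=> j; rewrite /b'' /ord_ext; case: insubP => [l _ <-|_]; [exact: b'_r | have := b_r j].
  by case/andP=> b0 bd; apply/andP; split=> //=; apply: le_lt_trans bd.
- by under [X in _ - X]eq_bigr => j _ do rewrite b''E.
Qed.
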